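(* Let $\mathcal{M}$ be an Abelian category. Every homogeneous valuation on $\mathcal{M}$ is push-out non-expansive, pull-back non-expansive, composition sub-additive, and monotone.
   Context: A valuation on $\mathcal{M}$ is a function $\omega\colon\mathrm{mor}(\mathcal{M})\to[0,\infty]$ such that (1) $\omega(f)=0$ whenever $f$ is an isomorphism, and (2) $\omega(0\colon X\to Y)=\omega(0\colon Y\to X)$ for all objects $X,Y$. A norm on $\mathcal{M}$ is a function $N\colon\mathrm{ob}(\mathcal{M})\to[0,\infty]$ such that (1) $N(0)=0$ for every zero object $0$, and (2) $\max\{N(X),N(Z)\}\le N(Y)\le N(X)+N(Z)$ for every exact sequence $0\to X\to Y\to Z\to 0$ in $\mathcal{M}$. The valuation associated with a norm $N$ is $N(f):=N(\ker(f))+N(\mathrm{coker}(f))$ for morphisms $f$. A valuation is called homogeneous if it is associated with some norm. Consider commutative squares with top $f\colon X_0\to X_1$, bottom $g\colon Y_0\to Y_1$, and vertical morphisms $X_0\to Y_0$, $X_1\to Y_1$. A valuation $\omega$ is called: - push-out non-expansive if $\omega(f)\ge\omega(g)$ for every such square that is a push-out; - pull-back non-expansive if $\omega(g)\ge\omega(f)$ for every such square that is a pull-back; - composition sub-additive if $\omega(gf)\le\omega(f)+\omega(g)$ for all composable $f\colon X\to Y$, $g\colon Y\to Z$; - monotone if $\omega(gf)\ge\max\{\omega(f),\omega(g)\}$ for all composable $f\colon X\to Y$, $g\colon Y\to Z$ such that $f$ is an epimorphism or $g$ is a monomorphism. *)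

(* Defs.v *)
From mathcomp Require Import all_boot all_order all_algebra.
From mathcomp Require Import boolp reals constructive_ereal.

Set Implicit Arguments.
Unset Strict Implicit.
Unset Printing Implicit Defensive.

Import Order.TTheory GRing.Theory Num.Theory.

Local Open Scope ring_scope.
Local Open Scope ereal_scope.

(* Categories enriched in abelian groups. The [choiceType] structure contained
   in [zmodType] is no restriction: classically every type carries one
   ([boolp.gen_choiceMixin]). *)
Record preadditive := Preadditive {
  ob :> Type;
  hom : ob -> ob -> zmodType;
  idm : forall X : ob, hom X X;
  compm : forall X Y Z : ob, hom Y Z -> hom X Y -> hom X Z;
  compmA : forall (W X Y Z : ob) (h : hom Y Z) (g : hom X Y) (f : hom W X),
    compm h (compm g f) = compm (compm h g) f;
  comp1m : forall (X Y : ob) (f : hom X Y), compm (idm Y) f = f;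
  compm1 : forall (X Y : ob) (f : hom X Y), compm f (idm X) = f;
  compmDl : forall (X Y Z : ob) (g g' : hom Y Z) (f : hom X Y),
    compm (g + g')%R f = (compm g f + compm g' f)%R;
  compmDr : forall (X Y Z : ob) (g : hom Y Z) (f f' : hom X Y),
    compm g (f + f')%R = (compm g f + compm g f')%R
}.

Arguments hom {p} X Y.
Arguments idm {p} X.
Arguments compm {p X Y Z} g f.

Notation "g '\oc' f" := (compm g f) (at level 40, left associativity).

Section Morphisms.
Variable C : preadditive.

Definition mono (X Y : C) (f : hom X Y) : Prop :=
  forall (W : C) (a b : hom W X), f \oc a = f \oc b -> a = b.

Definition epi (X Y : C) (f : hom X Y) : Prop :=
  forall (Z : C) (a b : hom Y Z), a \oc f = b \oc f -> a = b.

Definition isomorphism (X Y : C) (f : hom X Y) : Prop :=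
  exists g : hom Y X, g \oc f = idm X /\ f \oc g = idm Y.

Definition zero_object (O : C) : Prop :=
  forall X : C,
    (exists! f : hom O X, True) /\ (exists! f : hom X O, True).

Definition is_kernel (X Y : C) (f : hom X Y) (K : C) (k : hom K X) : Prop :=
  f \oc k = 0%R /\
  forall (W : C) (h : hom W X), f \oc h = 0%R ->
    exists! u : hom W K, k \oc u = h.

Definition is_cokernel (X Y : C) (f : hom X Y) (Q : C) (q : hom Y Q) : Prop :=
  q \oc f = 0%R /\
  forall (W : C) (h : hom Y W), h \oc f = 0%R ->
    exists! u : hom Q W, u \oc q = h.

Definition is_biproduct (X1 X2 B : C) (i1 : hom X1 B) (i2 : hom X2 B)
    (p1 : hom B X1) (p2 : hom B X2) : Prop :=
  [/\ p1 \oc i1 = idm X1, p2 \oc i2 = idm X2,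
      p1 \oc i2 = 0%R, p2 \oc i1 = 0%R &
      (i1 \oc p1 + i2 \oc p2)%R = idm B].

(* The image of [f] is the kernel of its cokernel. *)
Definition is_image (X Y : C) (f : hom X Y) (I : C) (i : hom I Y) : Prop :=
  exists (Q : C) (q : hom Y Q), is_cokernel f q /\ is_kernel q i.

(* X -f-> Y -g-> Z is exact at Y: one subobject of Y is both im f and ker g. *)
Definition exact_at (X Y Z : C) (f : hom X Y) (g : hom Y Z) : Prop :=
  exists (I : C) (i : hom I Y), is_image f i /\ is_kernel g i.

Definition short_exact (X Y Z : C) (f : hom X Y) (g : hom Y Z) : Prop :=
  exists2 O : C, zero_object O &
    [/\ exact_at (0%R : hom O X) f, exact_at f g & exact_at g (0%R : hom Z O)].

(*   X0 --f--> X1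
     |u        |v
     Y0 --g--> Y1  *)
Definition is_pushout (X0 X1 Y0 Y1 : C) (f : hom X0 X1) (g : hom Y0 Y1)
    (u : hom X0 Y0) (v : hom X1 Y1) : Prop :=
  v \oc f = g \oc u /\
  forall (W : C) (a : hom X1 W) (b : hom Y0 W), a \oc f = b \oc u ->
    exists! h : hom Y1 W, h \oc v = a /\ h \oc g = b.

Definition is_pullback (X0 X1 Y0 Y1 : C) (f : hom X0 X1) (g : hom Y0 Y1)
    (u : hom X0 Y0) (v : hom X1 Y1) : Prop :=
  v \oc f = g \oc u /\
  forall (W : C) (a : hom W X1) (b : hom W Y0), v \oc a = g \oc b ->
    exists! h : hom W X0, f \oc h = a /\ u \oc h = b.

End Morphisms.

Record abelian := Abelian {
  abelian_preadditive :> preadditive;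
  has_zero : exists O : abelian_preadditive, zero_object O;
  has_biproducts : forall X1 X2 : abelian_preadditive,
    exists (B : abelian_preadditive) (i1 : hom X1 B) (i2 : hom X2 B)
      (p1 : hom B X1) (p2 : hom B X2), is_biproduct i1 i2 p1 p2;
  has_kernels : forall (X Y : abelian_preadditive) (f : hom X Y),
    exists (K : abelian_preadditive) (k : hom K X), is_kernel f k;
  has_cokernels : forall (X Y : abelian_preadditive) (f : hom X Y),
    exists (Q : abelian_preadditive) (q : hom Y Q), is_cokernel f q;
  mono_normal : forall (X Y : abelian_preadditive) (f : hom X Y), mono f ->
    exists (Z : abelian_preadditive) (g : hom Y Z), is_kernel g f;
  epi_conormal : forall (X Y : abelian_preadditive) (f : hom X Y), epi f ->
    exists (W : abelian_preadditive) (g : hom W X), is_cokernel g f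
}.

(* The choice is immaterial: these objects are unique up to isomorphism. *)
Definition Ker (M : abelian) (X Y : M) (f : hom X Y) : M :=
  projT1 (cid (has_kernels f)).

Definition Coker (M : abelian) (X Y : M) (f : hom X Y) : M :=
  projT1 (cid (has_cokernels f)).

Record valuation (R : realType) (M : abelian) := Valuation {
  val_fun : forall X Y : M, hom X Y -> \bar R;
  val_ge0 : forall (X Y : M) (f : hom X Y), 0 <= val_fun f;
  val_iso : forall (X Y : M) (f : hom X Y), isomorphism f -> val_fun f = 0;
  val_zero : forall X Y : M,
    val_fun (0%R : hom X Y) = val_fun (0%R : hom Y X)
}.

Arguments val_fun {R M} v {X Y} f.

Record ob_norm (R : realType) (M : abelian) := Norm {
  norm_fun :> M -> \bar R;
  norm_ge0 : forall X : M, 0 <= norm_fun X;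
  norm_zero : forall O : M, zero_object O -> norm_fun O = 0;
  norm_exact : forall (X Y Z : M) (f : hom X Y) (g : hom Y Z),
    short_exact f g ->
    maxe (norm_fun X) (norm_fun Z) <= norm_fun Y /\
    norm_fun Y <= norm_fun X + norm_fun Z
}.

Section Valuations.
Variables (R : realType) (M : abelian).

Definition norm_mor (N : ob_norm R M) (X Y : M) (f : hom X Y) : \bar R :=
  N (Ker f) + N (Coker f).

Definition homogeneous (w : valuation R M) : Prop :=
  exists N : ob_norm R M, forall (X Y : M) (f : hom X Y),
    val_fun w f = norm_mor N f.

Definition pushout_nonexpansive (w : valuation R M) : Prop :=
  forall (X0 X1 Y0 Y1 : M) (f : hom X0 X1) (g : hom Y0 Y1)
    (u : hom X0 Y0) (v : hom X1 Y1),
    is_pushout f g u v -> val_fun w g <= val_fun w f.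

Definition pullback_nonexpansive (w : valuation R M) : Prop :=
  forall (X0 X1 Y0 Y1 : M) (f : hom X0 X1) (g : hom Y0 Y1)
    (u : hom X0 Y0) (v : hom X1 Y1),
    is_pullback f g u v -> val_fun w f <= val_fun w g.

Definition composition_subadditive (w : valuation R M) : Prop :=
  forall (X Y Z : M) (f : hom X Y) (g : hom Y Z),
    val_fun w (g \oc f) <= val_fun w f + val_fun w g.

Definition monotone_valuation (w : valuation R M) : Prop :=
  forall (X Y Z : M) (f : hom X Y) (g : hom Y Z),
    epi f \/ mono g ->
    maxe (val_fun w f) (val_fun w g) <= val_fun w (g \oc f).

End Valuations.

(* Main.v *)
(* Kernels are compared along a square or a composition by canonical maps: in a
   push-out square [ker f -> ker g] is an epimorphism, for a composition
   [ker f -> ker (g f) -> ker g] is left exact, and if [f] is an epimorphism then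
   [ker (g f) -> ker g] is one too. A norm is monotone along monomorphisms and
   epimorphisms and sub-additive along left exact sequences. Passing to the
   opposite category, on which a norm is still a norm, exchanges kernels with
   cokernels, push-outs with pull-backs and the two cases of monotonicity. *)
Require Import Defs.
From mathcomp Require Import all_boot all_order all_algebra.
From mathcomp Require Import boolp reals constructive_ereal.
(* [all_algebra] shadows [hom]. *)
Import Defs.

Set Implicit Arguments.
Unset Strict Implicit.
Unset Printing Implicit Defensive.

Import Order.TTheory GRing.Theory.

(** * Monomorphisms and kernels in a preadditive category, and its opposite *)

Section Preadditive.
Variable C : preadditive.
Implicit Types W X Y Z K Q : C.

Lemma comp0m X Y Z (f : hom X Y) : (0%R : hom Y Z) \oc f = 0%R.
Proof. by apply: (addrI (0%R \oc f)); rewrite -compmDl !addr0. Qed.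

Lemma compm0 X Y Z (g : hom Y Z) : g \oc (0%R : hom X Y) = 0%R.
Proof. by apply: (addrI (g \oc 0%R)); rewrite -compmDr !addr0. Qed.

Lemma compNm X Y Z (g : hom Y Z) (f : hom X Y) : (- g)%R \oc f = (- (g \oc f))%R.
Proof. by apply: (addrI (g \oc f)); rewrite -compmDl !subrr comp0m. Qed.

Lemma compmN X Y Z (g : hom Y Z) (f : hom X Y) : g \oc (- f)%R = (- (g \oc f))%R.
Proof. by apply: (addrI (g \oc f)); rewrite -compmDr !subrr compm0. Qed.

Lemma monoP X Y (f : hom X Y) :
  (forall W (a : hom W X), f \oc a = 0%R -> a = 0%R) -> mono f.
Proof.
move=> f0 W a b fab; apply/subr0_eq/f0.
by rewrite compmDr compmN fab subrr.
Qed.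

Lemma mono_eq0 X Y (f : hom X Y) W (a : hom W X) :
  mono f -> f \oc a = 0%R -> a = 0%R.
Proof. by move=> fm fa0; apply: fm; rewrite compm0. Qed.

Lemma mono_comp X Y Z (g : hom Y Z) (f : hom X Y) :
  mono g -> mono f -> mono (g \oc f).
Proof. by move=> gm fm W a b; rewrite -!compmA => /gm/fm. Qed.

Lemma mono_cancel X Y Z (g : hom Y Z) (f : hom X Y) : mono (g \oc f) -> mono f.
Proof. by move=> gfm W a b fab; apply: gfm; rewrite -!compmA fab. Qed.

Lemma kernel_comp0 X Y (f : hom X Y) K (k : hom K X) :
  is_kernel f k -> f \oc k = 0%R.
Proof. by case. Qed.

Lemma kernel_lift X Y (f : hom X Y) K (k : hom K X) W (h : hom W X) :
  is_kernel f k -> f \oc h = 0%R -> exists u, k \oc u = h.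
Proof. by case=> _ kl /kl[u [ku _]]; exists u. Qed.

Lemma kernel_mono X Y (f : hom X Y) K (k : hom K X) : is_kernel f k -> mono k.
Proof.
case=> fk0 kl W a b kab.
have /kl[u [_ uu]] : f \oc (k \oc b) = 0%R by rewrite compmA fk0 comp0m.
by rewrite -(uu _ kab) -(uu b).
Qed.

Lemma is_kernelI X Y (f : hom X Y) K (k : hom K X) :
  mono k -> f \oc k = 0%R ->
  (forall W (h : hom W X), f \oc h = 0%R -> exists u, k \oc u = h) ->
  is_kernel f k.
Proof.
move=> km fk0 kl; split=> // W h /kl[u ku]; exists u; split=> // u' ku'.
by apply: km; rewrite ku.
Qed.

(** Being a kernel of [g] depends only on the subobject: [i] and [f] factor through each other, so a
    lift through [i] becomes one through [f]. *)
Lemma kernel_iso X Y Z (g : hom Y Z) (i : hom X Y) W (f : hom W Y)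
    (a : hom W X) (b : hom X W) :
  is_kernel g i -> mono f -> i \oc a = f -> f \oc b = i -> is_kernel g f.
Proof.
move=> ki fm ia fb; apply: is_kernelI => //.
  by rewrite -ia compmA (kernel_comp0 ki) comp0m.
move=> V h /(kernel_lift ki)[u iu]; exists (b \oc u).
by rewrite compmA fb.
Qed.

(** [g] factors through [q], so whatever [q] kills is killed by [g] and lifts through [f]. *)
Lemma kernel_of_cokernel X Y Z (f : hom X Y) (g : hom Y Z) Q (q : hom Y Q) :
  is_kernel g f -> is_cokernel f q -> is_kernel q f.
Proof.
move=> kf [qf0 ql]; apply: is_kernelI => //; first exact: kernel_mono kf.
move=> W h qh0; apply: (kernel_lift kf).
have [u [<- _]] := ql _ _ (kernel_comp0 kf).
by rewrite -compmA qh0 compm0.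
Qed.

(** Objects and hom groups are kept as they are, so that dual statements follow by conversion. *)
Definition opposite_preadditive : preadditive :=
  @Preadditive (ob C) (fun X Y => hom Y X) (@idm C)
    (fun X Y Z g f => f \oc g)
    (fun W X Y Z h g f => esym (compmA f g h))
    (fun X Y f => compm1 f) (fun X Y f => comp1m f)
    (fun X Y Z g g' f => compmDr f g g') (fun X Y Z g f f' => compmDl f f' g).

End Preadditive.

(** * Epimorphisms and cokernels by duality; zero objects *)

Section PreadditiveDual.
Variable C : preadditive.
Implicit Types W X Y Z K Q : C.
Let D := opposite_preadditive C.

Lemma epiP X Y (f : hom X Y) :
  (forall W (a : hom Y W), a \oc f = 0%R -> a = 0%R) -> epi f.
Proof. exact: (@monoP D Y X f). Qed.

Lemma epi_eq0 X Y (f : hom X Y) W (a : hom Y W) :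
  epi f -> a \oc f = 0%R -> a = 0%R.
Proof. exact: (@mono_eq0 D Y X f W a). Qed.

Lemma epi_cancel X Y Z (g : hom Y Z) (f : hom X Y) : epi (g \oc f) -> epi g.
Proof. exact: (@mono_cancel D Z Y X f g). Qed.

Lemma cokernel_comp0 X Y (f : hom X Y) Q (q : hom Y Q) :
  is_cokernel f q -> q \oc f = 0%R.
Proof. by case. Qed.

Lemma cokernel_desc X Y (f : hom X Y) Q (q : hom Y Q) W (h : hom Y W) :
  is_cokernel f q -> h \oc f = 0%R -> exists u, u \oc q = h.
Proof. exact: (@kernel_lift D Y X f Q q W h). Qed.

Lemma cokernel_epi X Y (f : hom X Y) Q (q : hom Y Q) : is_cokernel f q -> epi q.
Proof. exact: (@kernel_mono D Y X f Q q). Qed.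

Lemma is_cokernelI X Y (f : hom X Y) Q (q : hom Y Q) :
  epi q -> q \oc f = 0%R ->
  (forall W (h : hom Y W), h \oc f = 0%R -> exists u, u \oc q = h) ->
  is_cokernel f q.
Proof. exact: (@is_kernelI D Y X f Q q). Qed.

Lemma cokernel_of_kernel X Y Z (g : hom Y Z) (f : hom X Y) K (k : hom K Y) :
  is_cokernel f g -> is_kernel g k -> is_cokernel k g.
Proof. exact: (@kernel_of_cokernel D Z Y X g f K k). Qed.

(** A self-dual criterion, which passes to the opposite category unchanged. *)
Lemma zero_objectP (O : C) : zero_object O <-> idm O = 0%R.
Proof.
split=> [/(_ O)[[f [_ uf]] _]|O0 X]; first by rewrite -(uf (idm O)) // -(uf 0%R).
split; exists 0%R; split=> // f _.
  by rewrite -(compm1 f) O0 compm0.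
by rewrite -(comp1m f) O0 comp0m.
Qed.

End PreadditiveDual.

(** * Images, short exact sequences, pull-backs and push-outs in an Abelian category *)

Section Abelian.
Variable M : abelian.
Implicit Types W X Y Z K Q : M.

Lemma Ker_kernel X Y (f : hom X Y) : exists k : hom (Ker f) X, is_kernel f k.
Proof. exact: projT2 (cid (has_kernels f)). Qed.

Lemma Coker_cokernel X Y (f : hom X Y) :
  exists q : hom Y (Coker f), is_cokernel f q.
Proof. exact: projT2 (cid (has_cokernels f)). Qed.

Lemma mono_kernel X Y (f : hom X Y) Q (q : hom Y Q) :
  mono f -> is_cokernel f q -> is_kernel q f.
Proof. by move=> /mono_normal[Z [g kf]]; apply: kernel_of_cokernel kf. Qed.

Lemma epi_cokernel X Y (g : hom X Y) K (k : hom K X) :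
  epi g -> is_kernel g k -> is_cokernel k g.
Proof. by move=> /epi_conormal[Z [f cg]]; apply: cokernel_of_kernel cg. Qed.

(** [m] is the kernel of the cokernel of [f]. If [h] kills [e], then [f] already factors through the
    kernel of [h], which must therefore be all of the image. *)
Lemma image_factor X Y (f : hom X Y) :
  exists (I : M) (m : hom I Y) (e : hom X I), [/\ mono m, epi e & m \oc e = f].
Proof.
have [q cq] := Coker_cokernel f; have [m km] := Ker_kernel q.
have [e me] := kernel_lift km (cokernel_comp0 cq).
have mm := kernel_mono km.
exists (Ker q), m, e; split=> //; apply: epiP => W h he0.
have [k kk] := Ker_kernel h; have [e' ke'] := kernel_lift kk he0.
(* [f] factors through [m k], which is the kernel of some [p]; hence [m] does
   too, and [k] is split epi. *)
have [Z [p kp]] := mono_normal (mono_comp mm (kernel_mono kk)).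
have pf0 : p \oc f = 0%R.
  by rewrite -me -ke' !compmA -(compmA p m k) (kernel_comp0 kp) comp0m.
have [p' p'q] := cokernel_desc cq pf0.
have pm0 : p \oc m = 0%R by rewrite -p'q -compmA (kernel_comp0 km) compm0.
have [s mks] := kernel_lift kp pm0.
have ks1 : k \oc s = idm _ by apply: mm; rewrite compmA mks compm1.
by rewrite -(compm1 h) -ks1 compmA (kernel_comp0 kk) comp0m.
Qed.

Lemma short_exactP X Y Z (f : hom X Y) (g : hom Y Z) :
  short_exact f g <-> is_kernel g f /\ is_cokernel f g.
Proof.
split=> [[O O0 [[I [i [[Q [q [cq kq]]] kf]]]
               [J [j [[Q' [q' [cq' kq']]] kg]]]
               [L [l [[Q'' [q'' [cq'' kq'']]] kz]]]]]|[kf cg]].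
  (* The cokernel [q] of the zero map from [O] has a left inverse, so its kernel [i] vanishes; [i]
     is also a kernel of [f]. *)
  have fm : mono f.
    apply: monoP => W a /(kernel_lift kf)[u <-].
    have [r rq] := cokernel_desc cq (compm0 O (idm X)).
    have i0 : i = 0%R.
      by rewrite -(comp1m i) -rq -compmA (kernel_comp0 kq) compm0.
    by rewrite i0 comp0m.
  (* Dually, [l] is a kernel of the zero map to [O], hence has a right inverse, and the cokernel
     [q''] of [g] vanishes. *)
  have ge : epi g.
    have [s ls] := kernel_lift kz (comp0m O (idm Z)).
    have q0 : q'' = 0%R.
      by rewrite -(compm1 q'') -ls compmA (kernel_comp0 kq'') comp0m.
    apply: epiP => W a /(cokernel_desc cq'')[u <-].
    by rewrite q0 compm0.
  (* [f] and [j] are both kernels of [q'], and [j] is a kernel of [g]. *)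
  have kf' := mono_kernel fm cq'.
  have [a ja] := kernel_lift kq' (kernel_comp0 kf').
  have [b fb] := kernel_lift kf' (kernel_comp0 kq').
  have kgf := kernel_iso kg fm ja fb.
  by split; last exact: epi_cokernel ge kgf.
have [O O0] := has_zero M; exists O => //.
have idO : idm O = 0%R by apply/zero_objectP.
have fm := kernel_mono kf; have ge := cokernel_epi cg.
have toO W (h : hom W O) : h = 0%R by rewrite -(comp1m h) idO comp0m.
have fromO W (h : hom O W) : h = 0%R by rewrite -(compm1 h) idO compm0.
have zk A B (p : hom A B) : mono p -> is_kernel p (0%R : hom O A).
  move=> pm; apply: is_kernelI; [|by rewrite compm0|].
  - by move=> W a b _; rewrite (toO _ a) (toO _ b).
  - by move=> W h /(mono_eq0 pm)->; exists 0%R; rewrite compm0.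
have zc A B (p : hom A B) : epi p -> is_cokernel p (0%R : hom B O).
  move=> pe; apply: is_cokernelI; [|by rewrite comp0m|].
  - by move=> W a b _; rewrite (fromO _ a) (fromO _ b).
  - by move=> W h /(epi_eq0 pe)->; exists 0%R; rewrite comp0m.
have idk A B : is_kernel (0%R : hom A B) (idm A).
  apply: is_kernelI; [|by rewrite comp0m|].
  - by move=> W a b; rewrite !comp1m.
  - by move=> W h _; exists h; rewrite comp1m.
have idc A B : is_cokernel (0%R : hom B A) (idm A).
  apply: is_cokernelI; [|by rewrite compm0|].
  - by move=> W a b; rewrite !compm1.
  - by move=> W h _; exists h; rewrite compm1.
have idm_mono A : mono (idm A) by move=> W a b; rewrite !comp1m.
(* The images at the three places are [0], [f] and [idm Z], with cokernels [idm X], [g] and [0]. *)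
split.
- by exists O, 0%R; split; [exists X, (idm X); split; [|exact: zk]|exact: zk].
- by exists X, f; split; [exists Z, g|].
- by exists Z, (idm Z); split; [exists O, 0%R; split; [exact: zc|]|].
Qed.

(** The pull-back is cut out of the biproduct of [X] and [Y] by the difference of the two maps to
    [Z]. *)
Lemma pullback_exists X Y Z (v : hom X Z) (g : hom Y Z) :
  exists (P : M) (f : hom P X) (u : hom P Y), is_pullback f g u v.
Proof.
have [B [i1 [i2 [p1 [p2 [p1i1 p2i2 p1i2 p2i1 ip]]]]]] := has_biproducts X Y.
have [k kk] := Ker_kernel (v \oc p1 - g \oc p2)%R.
exists _, (p1 \oc k), (p2 \oc k); split.
  by apply/subr0_eq; rewrite -(kernel_comp0 kk) compmDl compNm !compmA.
move=> W a b vagb.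
have h0 : (v \oc p1 - g \oc p2)%R \oc (i1 \oc a + i2 \oc b)%R = 0%R.
  rewrite compmDr !compmDl !compNm !compmA -!(compmA v) -!(compmA g).
  rewrite p1i1 p1i2 p2i1 p2i2 !comp1m !comp0m !compm0 vagb.
  by rewrite subr0 sub0r subrr.
have [h kh] := kernel_lift kk h0; exists h; split.
  rewrite -!compmA kh !compmDr !compmA p1i1 p1i2 p2i1 p2i2.
  by rewrite !comp1m !comp0m addr0 add0r.
move=> h' [ea eb]; apply: (kernel_mono kk); rewrite kh -ea -eb.
by rewrite -[RHS]comp1m -ip compmDl !compmA.
Qed.

Lemma pullback_epi X0 X1 Y0 Y1 (f : hom X0 X1) (g : hom Y0 Y1)
    (u : hom X0 Y0) (v : hom X1 Y1) :
  is_pullback f g u v -> epi g -> epi f.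
Proof.
move=> [vfgu pb] ge.
have [B [i1 [i2 [p1 [p2 [p1i1 p2i2 p1i2 p2i1 ip]]]]]] := has_biproducts X1 Y0.
(* [f] and [u] make [X0] the kernel of [phi : X1 + Y0 -> Y1], which is epi. *)
pose phi : hom B Y1 := (v \oc p1 - g \oc p2)%R.
have phii2 : phi \oc i2 = (- g)%R.
  by rewrite compmDl compNm -!compmA p1i2 p2i2 compm0 compm1 sub0r.
have phie : epi phi.
  apply: epiP => W a a0; apply: (epi_eq0 ge).
  by rewrite -(opprK g) -phii2 compmN compmA a0 comp0m oppr0.
have [k kk] := Ker_kernel phi; have ck := epi_cokernel phie kk.
apply: epiP => W h hf0.
have [t fut] : exists t, f \oc t = p1 \oc k.
  have [|t [[ft _] _]] := pb _ (p1 \oc k) (p2 \oc k); last by exists t.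
  apply/subr0_eq; rewrite !compmA -compNm -compmDl; exact: kernel_comp0 kk.
(* [h p1] kills the kernel of [phi], so it equals [s phi]; restricting to [Y0] along [i2] gives
   [s g = 0]. *)
have hpk0 : (h \oc p1) \oc k = 0%R by rewrite -compmA -fut compmA hf0 comp0m.
have [s sphi] := cokernel_desc ck hpk0.
have s0 : s = 0%R.
  apply: (epi_eq0 ge); apply: oppr_inj.
  by rewrite -compmN -phii2 compmA sphi -compmA p1i2 compm0 oppr0.
by rewrite -(compm1 h) -p1i1 compmA -sphi s0 !comp0m.
Qed.

(** In terms of elements: if [g y = 0], then [(0, y)] dies in the push-out, so it is
    [phi x = (f x, - u x)] for some [x]; thus [f x = 0] and [y = u (- x)]. *)
Lemma pushout_kernel_epi X0 X1 Y0 Y1 (f : hom X0 X1) (g : hom Y0 Y1)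
    (u : hom X0 Y0) (v : hom X1 Y1) K (k : hom K X0) L (l : hom L Y0)
    (w : hom K L) :
  is_pushout f g u v -> is_kernel f k -> is_kernel g l -> l \oc w = u \oc k ->
  epi w.
Proof.
move=> [vfgu po] kk kl lw.
have [B [i1 [i2 [p1 [p2 [p1i1 p2i2 p1i2 p2i1 ip]]]]]] := has_biproducts X1 Y0.
(* [v] and [g] make [Y1] the cokernel of [phi : X0 -> X1 + Y0], so [i2 l]
   factors through the image of [phi]; lift it to [X0] along an epimorphism. *)
pose phi : hom X0 B := (i1 \oc f - i2 \oc u)%R.
have p1phi : p1 \oc phi = f.
  by rewrite compmDr compmN !compmA p1i1 p1i2 comp1m comp0m subr0.
have p2phi : p2 \oc phi = (- u)%R.
  by rewrite compmDr compmN !compmA p2i1 p2i2 comp1m comp0m sub0r.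
have [I [m [e [mm ee me]]]] := image_factor phi.
have [q cq] := Coker_cokernel m; have km := mono_kernel mm cq.
have qphi0 : q \oc phi = 0%R by rewrite -me compmA (cokernel_comp0 cq) comp0m.
(* Since [q phi = 0], the maps [q i1] and [q i2] form a cocone on the push-out square; the induced
   [h] gives [q i2 = h g], which kills [l]. *)
have qi2l0 : q \oc (i2 \oc l) = 0%R.
  have [|h [[_ hg] _]] := po _ (q \oc i1) (q \oc i2).
    by apply/subr0_eq; rewrite -!compmA -compmN -compmDr.
  by rewrite compmA -hg -compmA (kernel_comp0 kl) compm0.
have [s ms] := kernel_lift km qi2l0.
have [P [e' [s' pb]]] := pullback_exists s e.
have e'e := pullback_epi pb ee; case: pb => se' _.
have phis' : phi \oc s' = i2 \oc l \oc e'.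
  by rewrite -me -compmA -se' compmA ms.
have fs'0 : f \oc s' = 0%R.
  by rewrite -p1phi -compmA phis' !compmA p1i2 !comp0m.
have [t kt] := kernel_lift kk fs'0.
have le' : l \oc e' = l \oc (w \oc (- t)%R).
  rewrite compmA lw compmN -compmA kt -compNm -p2phi -compmA phis' !compmA.
  by rewrite p2i2 comp1m.
have e'wt := kernel_mono kl le'.
by apply: (@epi_cancel _ _ _ _ _ (- t)%R); rewrite -e'wt.
Qed.

End Abelian.

Definition opposite (M : abelian) : abelian.
Proof.
refine (@Abelian (opposite_preadditive M) _ _
  (fun X Y f => @has_cokernels M Y X f)
  (fun X Y f => @has_kernels M Y X f)
  (fun X Y f => @epi_conormal M Y X f) (fun X Y f => @mono_normal M Y X f)).
- have [O O0] := has_zero M; exists O => X.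
  by have [] := O0 X.
- move=> X Y; have [B [i1 [i2 [p1 [p2 []]]]]] := has_biproducts X Y.
  by move=> *; exists B, p1, p2, i1, i2; split.
Defined.

(** * Estimates for norms of kernels and cokernels *)

Section Norm.
Variable R : realType.
Local Open Scope ereal_scope.

Section OneSided.
Variables (M : abelian) (N : ob_norm R M).
Implicit Types X Y Z : M.

Lemma norm_kernel_cokernel X Y Z (f : hom X Y) (g : hom Y Z) :
  is_kernel g f -> is_cokernel f g ->
  [/\ N X <= N Y, N Z <= N Y & N Y <= N X + N Z].
Proof.
move=> kf cg; have /norm_exact-/(_ R N)[] : short_exact f g by apply/short_exactP.
by rewrite ge_max => /andP[].
Qed.

Lemma norm_mono X Y (f : hom X Y) : mono f -> N X <= N Y.
Proof.
move=> fm; have [q cq] := Coker_cokernel f.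
by have [] := norm_kernel_cokernel (mono_kernel fm cq) cq.
Qed.

Lemma norm_epi X Y (f : hom X Y) : epi f -> N Y <= N X.
Proof.
move=> fe; have [k kk] := Ker_kernel f.
by have [] := norm_kernel_cokernel kk (epi_cokernel fe kk).
Qed.

(** Replacing [Z] by the image of [g] makes the sequence short exact, and the image embeds in
    [Z]. *)
Lemma norm_left_exact X Y Z (f : hom X Y) (g : hom Y Z) :
  is_kernel g f -> N Y <= N X + N Z.
Proof.
move=> kf; have [I [m [e [mm ee me]]]] := image_factor g.
have ke : is_kernel e f.
  apply: is_kernelI; first exact: kernel_mono kf.
    by apply: (mono_eq0 mm); rewrite compmA me (kernel_comp0 kf).
  by move=> W h eh0; apply: (kernel_lift kf); rewrite -me -compmA eh0 compm0.
have [_ _ /le_trans] := norm_kernel_cokernel ke (epi_cokernel ee ke).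
by apply; rewrite leeD2l// (norm_mono mm).
Qed.

Lemma norm_Coker_epi X Y (f : hom X Y) : epi f -> N (Coker f) = 0.
Proof.
move=> fe; have [q cq] := Coker_cokernel f.
apply: norm_zero; apply/zero_objectP; apply: (cokernel_epi cq).
by rewrite comp1m comp0m; apply: (epi_eq0 fe); apply: cokernel_comp0 cq.
Qed.

Lemma norm_mor_pushout X0 X1 Y0 Y1 (f : hom X0 X1) (g : hom Y0 Y1)
    (u : hom X0 Y0) (v : hom X1 Y1) :
  is_pushout f g u v -> norm_mor N g <= norm_mor N f.
Proof.
move=> po; have [vfgu pou] := po; apply: leeD.
  have [k kk] := Ker_kernel f; have [l kl] := Ker_kernel g.
  have [|w lw] := @kernel_lift _ _ _ _ _ _ _ (u \oc k) kl.
    by rewrite compmA -vfgu -compmA (kernel_comp0 kk) compm0.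
  exact: norm_epi (pushout_kernel_epi po kk kl lw).
have [q cq] := Coker_cokernel f; have [r cr] := Coker_cokernel g.
have [|w wq] := @cokernel_desc _ _ _ _ _ _ _ (r \oc v) cq.
  by rewrite -compmA vfgu compmA (cokernel_comp0 cr) comp0m.
(* The map [w] induced on cokernels is epi: if [a w = 0], then [a r] vanishes on both [v] and [g],
   so it is zero by uniqueness in the push-out. *)
apply: (@norm_epi _ _ w); apply: epiP => W a aw0; apply: (epi_eq0 (cokernel_epi cr)).
have arv0 : (a \oc r) \oc v = 0%R by rewrite -compmA -wq compmA aw0 comp0m.
have arg0 : (a \oc r) \oc g = 0%R by rewrite -compmA (cokernel_comp0 cr) compm0.
have [|h [_ uh]] := pou W 0%R 0%R; first by rewrite !comp0m.
by rewrite -(uh (a \oc r)) // -(uh 0%R) // !comp0m.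
Qed.

Lemma norm_Ker_comp X Y Z (f : hom X Y) (g : hom Y Z) :
  N (Ker (g \oc f)) <= N (Ker f) + N (Ker g).
Proof.
have [k kk] := Ker_kernel f; have [l kl] := Ker_kernel g.
have [m km] := Ker_kernel (g \oc f).
have [|a la] := @kernel_lift _ _ _ _ _ _ _ (f \oc m) kl.
  by rewrite compmA (kernel_comp0 km).
have [|b mb] := @kernel_lift _ _ _ _ _ _ _ k km.
  by rewrite -compmA (kernel_comp0 kk) compm0.
(* [b] is the inclusion of [Ker f] and [a] the restriction of [f]; what [a] kills is killed by [f],
   hence lies in [Ker f]. *)
apply: (@norm_left_exact _ _ _ b a); apply: is_kernelI.
- by apply: (@mono_cancel _ _ _ _ m); rewrite mb; apply: kernel_mono kk.
- apply: (mono_eq0 (kernel_mono kl)).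
  by rewrite compmA la -compmA mb (kernel_comp0 kk).
- move=> W h ah0; have [|c kc] := @kernel_lift _ _ _ _ _ _ _ (m \oc h) kk.
    by rewrite compmA -la -compmA ah0 compm0.
  by exists c; apply: (kernel_mono km); rewrite compmA mb.
Qed.

Lemma norm_mor_comp_epi X Y Z (f : hom X Y) (g : hom Y Z) :
  epi f -> maxe (norm_mor N f) (norm_mor N g) <= norm_mor N (g \oc f).
Proof.
move=> fe; have [k kk] := Ker_kernel f; have [l kl] := Ker_kernel g.
have [m km] := Ker_kernel (g \oc f).
have [q cq] := Coker_cokernel g; have [r cr] := Coker_cokernel (g \oc f).
have [|b mb] := @kernel_lift _ _ _ _ _ _ _ k km.
  by rewrite -compmA (kernel_comp0 kk) compm0.
have [|a la] := @kernel_lift _ _ _ _ _ _ _ (f \oc m) kl.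
  by rewrite compmA (kernel_comp0 km).
have [|c cr'] := @cokernel_desc _ _ _ _ _ _ _ q cr.
  by rewrite compmA (cokernel_comp0 cq) comp0m.
rewrite ge_max; apply/andP; split; apply: leeD.
- by apply/(@norm_mono _ _ b)/(@mono_cancel _ _ _ _ m); rewrite mb; apply: kernel_mono kk.
- by rewrite norm_Coker_epi // norm_ge0.
(* [a] is the pull-back of the epimorphism [f] along [l]: if [l s = f t], then [g f t = 0], so [t]
   lifts to [Ker (g f)]. *)
- apply: (@norm_epi _ _ a); apply: (pullback_epi (g := f) (u := m) (v := l)) => //.
  split=> // W s t lsft; have [|h mh] := @kernel_lift _ _ _ _ _ _ _ t km.
    by rewrite -compmA -lsft compmA (kernel_comp0 kl) comp0m.
  exists h; split=> [|h' [_ mh']]; last by apply: (kernel_mono km); rewrite mh.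
  by split=> //; apply: (kernel_mono kl); rewrite compmA la -compmA mh.
- by apply/(@norm_epi _ _ c)/(@epi_cancel _ _ _ _ c r); rewrite cr'; apply: cokernel_epi cq.
Qed.

(** Duality swaps the two ends of a short exact sequence, and the bounds are symmetric in them. *)
Lemma opposite_norm_exact (X Y Z : opposite M) (f : hom X Y) (g : hom Y Z) :
  short_exact f g -> maxe (N X) (N Z) <= N Y /\ N Y <= N X + N Z.
Proof.
move=> /short_exactP[kf cg]; rewrite ge_max addeC.
by have [-> -> ->] := @norm_kernel_cokernel Z Y X g f cg kf.
Qed.

Lemma opposite_norm_zero (O : opposite M) : zero_object O -> N O = 0.
Proof. by move=> /zero_objectP O0; apply: norm_zero; apply/zero_objectP. Qed.

Definition opposite_norm : ob_norm R (opposite M) :=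
  @Norm R (opposite M) N (@norm_ge0 _ _ N) opposite_norm_zero opposite_norm_exact.

(* [Ker] in [opposite M] is convertible to [Coker] in [M], choices included. *)
Lemma opposite_norm_mor X Y (f : hom X Y) :
  norm_mor opposite_norm (f : @hom (opposite M) Y X) = norm_mor N f.
Proof. exact: addeC. Qed.

End OneSided.

(** * The remaining estimates, by passing to the opposite category *)

Section Dual.
Variables (M : abelian) (N : ob_norm R M).
Implicit Types X Y Z : M.

Lemma norm_mor_pullback X0 X1 Y0 Y1 (f : hom X0 X1) (g : hom Y0 Y1)
    (u : hom X0 Y0) (v : hom X1 Y1) :
  is_pullback f g u v -> norm_mor N f <= norm_mor N g.
Proof.
move=> [vfgu pb]; rewrite -(opposite_norm_mor N f) -(opposite_norm_mor N g).
(* With all arrows reversed, [g] becomes the top of the square and [f] the bottom, so [u] and [v]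
   trade places. *)
apply: (@norm_mor_pushout (opposite M) _ _ _ _ _ g f v u); split; first exact: esym.
move=> W a b gavb; have [h [[fh uh] hu]] := pb W b a (esym gavb).
by exists h; split=> // h' [? ?]; apply: hu.
Qed.

Lemma norm_mor_comp X Y Z (f : hom X Y) (g : hom Y Z) :
  norm_mor N (g \oc f) <= norm_mor N f + norm_mor N g.
Proof.
rewrite /norm_mor addeACA; apply: leeD; first exact: norm_Ker_comp.
(* The cokernel summands are kernels in the opposite category, where the composite is taken in the
   reverse order. *)
rewrite addeC; exact: (@norm_Ker_comp (opposite M) (opposite_norm N) Z Y X g f).
Qed.

Lemma norm_mor_comp_mono X Y Z (f : hom X Y) (g : hom Y Z) :
  mono g -> maxe (norm_mor N f) (norm_mor N g) <= norm_mor N (g \oc f).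
Proof.
move=> gm; rewrite maxC -(opposite_norm_mor N f) -(opposite_norm_mor N g).
rewrite -(opposite_norm_mor N (g \oc f)).
exact: (@norm_mor_comp_epi (opposite M) (opposite_norm N) Z Y X g f gm).
Qed.

End Dual.
End Norm.

Theorem proposition4p3 (R : realType) (M : abelian) (w : valuation R M)
    (hw : homogeneous w) :
  [/\ pushout_nonexpansive w, pullback_nonexpansive w,
      composition_subadditive w & monotone_valuation w].
Proof.
have [N wN] := hw; split.
- by move=> X0 X1 Y0 Y1 f g u v /(norm_mor_pushout N); rewrite !wN.
- by move=> X0 X1 Y0 Y1 f g u v /(norm_mor_pullback N); rewrite !wN.
- by move=> X Y Z f g; rewrite !wN; apply: norm_mor_comp.
- move=> X Y Z f g; rewrite !wN => -[/norm_mor_comp_epi|/norm_mor_comp_mono]; exact.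
Qed.
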